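(* Consider online algorithms with advice for Minimum Vertex Cover that, on every triangle-free graph of maximum degree $3$ and every arrival order of its vertices, accept a minimum-size vertex cover. Asymptotically, for $n\ge 7$, no such online algorithm uses fewer than $(n-4)/3$ bits of advice on $n$-vertex inputs; that is, for every such algorithm there are arbitrarily large $n\geq 7$ for which, on some triangle-free $n$-vertex graph of maximum degree $3$ (with some arrival order), the algorithm reads at least $(n-4)/3$ bits of advice.
   Context: Minimum Vertex Cover: given a finite simple undirected graph $G=(V,E)$, find a minimum-size $S\subseteq V$ such that every edge has an endpoint in $S$. ''Maximum degree $3$'' means all degrees are at most $3$. Online setting with advice (vertex arrival, vertex adjacency model, advice tape model): the vertices arrive one at a time in an order chosen by an adversary. Each arriving input item is a pair $(v,N(v))$, a vertex name with the list of names of all its neighbors (including those that have not yet arrived). Upon arrival of each vertex the deterministic algorithm must irrevocably accept (include in the cover) or reject it, based only on the items received so far and the advice read so far. An oracle that knows the algorithm and the whole input sequence writes an infinite binary advice tape beforehand; before each decision the algorithm may read zero or more further bits sequentially from the tape. The advice used on an input is the number of bits read. *)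

(* Defs.v *)
From mathcomp Require Import all_boot all_order all_algebra.
From mathcomp Require Import finmap.

Set Implicit Arguments.
Unset Strict Implicit.
Unset Printing Implicit Defensive.

Local Open Scope fset_scope.

(* Vertices are identified with their names, which are arbitrary natural
   numbers (not necessarily 0, ..., n-1). *)
Record sgraph := SGraph {
  vertices : {fset nat};
  adj : rel nat;
  adj_sym : symmetric adj;
  adj_irr : irreflexive adj;
  adj_vertices : forall u v, adj u v -> u \in vertices
}.

Definition neighbors (G : sgraph) (v : nat) : {fset nat} :=
  [fset u in vertices G | adj G v u].

Definition triangle_free (G : sgraph) : Prop :=
  forall x y z, ~ [/\ adj G x y, adj G y z & adj G x z].

Definition max_degree_le (G : sgraph) (d : nat) : Prop :=
  forall v, v \in vertices G -> #|` neighbors G v| <= d.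

Definition vertex_cover (G : sgraph) (S : {fset nat}) : Prop :=
  S `<=` vertices G /\ forall u v, adj G u v -> (u \in S) || (v \in S).

Definition min_vertex_cover (G : sgraph) (S : {fset nat}) : Prop :=
  vertex_cover G S /\ forall T, vertex_cover G T -> #|` S| <= #|` T|.

(* An input item (v, N(v)); N(v) includes the neighbors still to arrive. *)
Definition item := (nat * {fset nat})%type.

Definition arrival_order (G : sgraph) (sigma : seq nat) : Prop :=
  perm_eq sigma (vertices G).

Definition input (G : sgraph) (sigma : seq nat) : seq item :=
  [seq (v, neighbors G v) | v <- sigma].

Definition tape := nat -> bool.

(* [A s w] is the next action once the items [s] have arrived (the last one
   is awaiting its decision) and [w] is the advice read so far: [None] reads
   one more bit, [Some true] accepts and [Some false] rejects the last item.
   Earlier decisions are not passed to [A], since they are determined by [s]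
   and [w]. *)
Definition algorithm := seq item -> seq bool -> option bool.

Definition oracle := seq item -> tape.

(* With [r] bits already read when the last item of [s] arrives, [A] reads on
   until [r'] bits have been read in total and then makes decision [b].
   If [A] never stops reading, no such [r'] exists. *)
Definition decides (A : algorithm) (t : tape) (s : seq item)
    (r r' : nat) (b : bool) : Prop :=
  [/\ r <= r',
      forall j, r <= j < r' -> A s (mkseq t j) = None
    & A s (mkseq t r') = Some b].

(* [run A t s ds r]: on input [s] with tape [t], the successive decisions of
   [A] are [ds], and [r] bits of advice have been read in total. *)
Inductive run (A : algorithm) (t : tape) : seq item -> seq bool -> nat -> Prop :=
| run_nil : run A t [::] [::] 0
| run_rcons s x ds r r' b :
    run A t s ds r -> decides A t (rcons s x) r r' b ->
    run A t (rcons s x) (rcons ds b) r'.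

Definition accepted (sigma : seq nat) (ds : seq bool) : {fset nat} :=
  [fset v in mask ds sigma].

Definition optimal_on (A : algorithm) (O : oracle)
    (G : sgraph) (sigma : seq nat) : Prop :=
  exists ds r, run A (O (input G sigma)) (input G sigma) ds r /\
    min_vertex_cover G (accepted sigma ds).

Definition reads_bits (A : algorithm) (O : oracle)
    (G : sgraph) (sigma : seq nat) (r : nat) : Prop :=
  exists ds, run A (O (input G sigma)) (input G sigma) ds r.

(* Main.v *)
(* Let k be odd and n = 3k. The first k vertices to arrive are the middles of k
   disjoint paths 3i, 3i+1, 3i+2. For a set X of more than half of the middles,
   let C consist of the middles in X and of the end vertices of the other
   paths. Order the paths so that those with middle in X alternate with the
   others, the surplus ones coming last, and join consecutive end vertices
   whenever exactly one of them is in C. The result is a union of paths in which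
   C is the unique minimum vertex cover, so X has to be the set of accepted
   middles. There are 2^(k-1) such X, all with the same first k items, hence some
   input requires k - 1 >= (n - 4) / 3 bits. *)
Require Import Defs.
From mathcomp Require Import all_boot all_order all_algebra.
From mathcomp Require Import finmap.
From mathcomp Require Import zify.

Set Implicit Arguments.
Unset Strict Implicit.
Unset Printing Implicit Defensive.

Import Order.TTheory GRing.Theory Num.Theory.
Local Open Scope fset_scope.

(** * Runs of an online algorithm and the advice they consume *)

Lemma run_size A t s ds r : run A t s ds r -> size ds = size s.
Proof. by elim=> // s' x ds' r1 r2 b _ IH _; rewrite !size_rcons IH. Qed.

Lemma run_nil_inv A t ds r : run A t [::] ds r -> ds = [::] /\ r = 0.
Proof.
move E: [::] => s H; case: H E => // s' x ds' r1 r2 b _ _ /(congr1 size).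
by rewrite size_rcons.
Qed.

Lemma run_rcons_inv A t s x ds r' : run A t (rcons s x) ds r' ->
  exists ds0 r b, [/\ ds = rcons ds0 b, run A t s ds0 r &
                      decides A t (rcons s x) r r' b].
Proof.
move E: (rcons s x) => u H; case: H E => [/(congr1 size)|].
  by rewrite size_rcons.
by move=> s' x' ds' r1 r2 b Hrun Hdec /rcons_inj [-> _]; exists ds', r1, b.
Qed.

Lemma run_prefix A t s1 s2 ds r : run A t (s1 ++ s2) ds r ->
  exists2 r1, r1 <= r & run A t s1 (take (size s1) ds) r1.
Proof.
elim/last_ind: s2 ds r => [|s2 x IH] ds r.
  by rewrite cats0 => H; exists r; rewrite // -(run_size H) take_size.
rewrite -rcons_cat => /run_rcons_inv [ds0 [r0 [b [-> H [ler _ _]]]]].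
have [r1 le1 H1] := IH _ _ H; exists r1; first exact: leq_trans le1 ler.
by rewrite -cats1 takel_cat // (run_size H) size_cat leq_addr.
Qed.

Lemma run_eq_tape A t t' s ds r :
  (forall j, j < r -> t j = t' j) -> run A t s ds r -> run A t' s ds r.
Proof.
move=> eqt H; elim: H eqt => [|s' x ds' r1 r2 b _ IH [le12 Hread Hstop]] eqt.
  exact: run_nil.
have eq_mkseq j : j <= r2 -> mkseq t' j = mkseq t j.
  move=> lej; apply/eq_in_map => i; rewrite mem_iota => /andP[_ lti].
  by rewrite eqt //; lia.
apply: (@run_rcons _ _ _ _ _ r1); first by apply: IH => j ltj; apply: eqt; lia.
split=> // [j /andP[ge1 lt2]|]; rewrite eq_mkseq //; last exact: ltnW.
by apply: Hread; rewrite ge1.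
Qed.

Lemma decides_inj A t s r r1 r2 b1 b2 :
  decides A t s r r1 b1 -> decides A t s r r2 b2 -> r1 = r2 /\ b1 = b2.
Proof.
move=> [le1 read1 stop1] [le2 read2 stop2].
have [lt|lt|eq] := ltngtP r1 r2.
- by rewrite read2 ?le1 in stop1.
- by rewrite read1 ?le2 in stop2.
by move: stop2; rewrite -eq stop1 => -[].
Qed.

Lemma run_inj A t s ds1 ds2 r1 r2 :
  run A t s ds1 r1 -> run A t s ds2 r2 -> ds1 = ds2 /\ r1 = r2.
Proof.
move=> H; elim: H ds2 r2 => [|s' x ds r r' b _ IH dec] ds2 r2.
  by move=> /run_nil_inv [-> ->].
move=> /run_rcons_inv [ds0 [r0 [b0 [-> /IH [<- <-]]]]].
by move=> /(decides_inj dec) [-> ->].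
Qed.

(** A run that reads at most [b] bits is determined by the items and the first [b] bits of its tape.
    Distinct decision sequences on the same items therefore need distinct [b]-bit prefixes. *)
Lemma advice_lower_bound (A : algorithm) (s : seq item) (b : nat)
    (I : finType) (t : I -> tape) (ds : I -> seq bool) :
  (forall i, exists2 r, r <= b & run A (t i) s (ds i) r) -> injective ds ->
  #|I| <= 2 ^ b.
Proof.
move=> Hrun ds_inj; pose f i : b.-tuple bool := [tuple t i j | j < b].
have f_inj : injective f.
  move=> i j eqf; apply: ds_inj.
  have [r le_rb Hi] := Hrun i; have [r' _ Hj] := Hrun j.
  apply: (run_inj _ Hj).1; apply: run_eq_tape Hi => l ltl.
  have := congr1 (fun u => tnth u (Ordinal (leq_trans ltl le_rb))) eqf.
  by rewrite !tnth_mktuple.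
by have := leq_card f f_inj; rewrite card_tuple card_bool.
Qed.

(** * Unions of paths with a prescribed minimum vertex cover *)

Section PathGraph.

Variables (p : seq nat) (a : pred nat).

(** The predicate [a] is the cover to be forced. Keeping only the consecutive pairs on which [a]
    differs makes it both a cover and a proper 2-colouring. *)
Definition path_adj : rel nat := fun u v =>
  [&& u \in p, v \in p, a u != a v &
      (index v p == (index u p).+1) || (index u p == (index v p).+1)].

Lemma path_adj_sym : symmetric path_adj.
Proof.
by move=> u v; rewrite /path_adj andbCA (eq_sym (a u)) (orbC (index v p == _)).
Qed.

Lemma path_adj_irr : irreflexive path_adj.
Proof. by move=> u; rewrite /path_adj eqxx !andbF. Qed.

Lemma path_adj_vertices u v : path_adj u v -> u \in [fset x in p].
Proof. by rewrite in_fset => /and4P[]. Qed.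

Definition path_graph : sgraph :=
  SGraph path_adj_sym path_adj_irr path_adj_vertices.

(** The 2-colouring [a] makes the graph bipartite. *)
Lemma path_graph_triangle_free : triangle_free path_graph.
Proof.
move=> x y z [/and4P[_ _ + _] /and4P[_ _ + _] /and4P[_ _ + _]].
by case: (a x); case: (a y); case: (a z).
Qed.

Lemma path_graph_max_degree : max_degree_le path_graph 2.
Proof.
move=> v _; set i := index v p.
(* If [v] comes first then [i.-1] is 0 and the first candidate is [v] itself, which is harmless in
   an upper bound. *)
have sub : neighbors path_graph v `<=` [fset nth 0 p i.-1; nth 0 p i.+1].
  apply/fsubsetP => u; rewrite !inE /= => /andP[_] /and4P[_ up _ /orP[]] /eqP idx.
    by rewrite -/i in idx; rewrite -idx nth_index ?eqxx ?orbT.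
  by rewrite -/i in idx; rewrite idx /= nth_index ?eqxx.
apply: leq_trans (fsubset_leq_card sub) _.
by rewrite cardfs2; case: (_ != _).
Qed.

Hypothesis p_uniq : uniq p.

(** Applied to the middles: their neighbourhoods do not reveal on which side of [a] they lie. *)
Lemma neighbors_path_graph p1 p2 x y z : p = p1 ++ [:: x, y, z & p2] ->
  a x != a y -> a z != a y -> neighbors path_graph y = [fset x; z].
Proof.
move=> Ep axy azy.
have idx j : j < 3 -> index (nth 0 [:: x; y; z] j) p = (size p1 + j)%N.
  move=> ltj; have -> : nth 0 [:: x; y; z] j = nth 0 p (size p1 + j)%N.
    rewrite Ep nth_cat ltnNge leq_addr /= addKn.
    by case: j ltj => [|[|[]]].
  by rewrite index_uniq // Ep size_cat /=; lia.
have [ix iy iz] := And3 (idx 0 isT) (idx 1 isT) (idx 2 isT).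
rewrite /= in ix iy iz.
have [xp yp zp] : [/\ x \in p, y \in p & z \in p].
  by rewrite Ep !mem_cat !inE !eqxx !orbT.
apply/fsetP => u; rewrite !inE /= /path_adj iy.
apply/idP/orP => [/andP[up /and4P[_ _ _ iu]]|[]/eqP->].
- have {}iu : index u p = index x p \/ index u p = index z p.
    by rewrite ix iz; move: (index u p) iu => i; lia.
  by case: iu => iu; [left|right]; apply/eqP; apply: (@index_inj _ 0 p).
- by rewrite xp yp eq_sym axy ix /=; lia.
by rewrite zp yp eq_sym azy iz /=; lia.
Qed.

Lemma card_fset_count (S : {fset nat}) :
  S `<=` [fset x in p] -> #|` S| = count (mem S) p.
Proof.
move=> /fsubsetP sub; rewrite -size_filter; apply: perm_size; apply: uniq_perm.
- exact: fset_uniq.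
- exact: filter_uniq.
move=> x; rewrite mem_filter /=; case xS: (x \in S) => //.
by have := sub _ xS; rewrite in_fset => ->.
Qed.

End PathGraph.

(* Pair every vertex of [a] with its successor, which is outside [a]: a cover
   as small as [a] has exactly one vertex in each pair and none elsewhere, and
   from the left end onwards this determines it. *)
Lemma path_cover_forced (a S : pred nat) x s :
  path (fun u v => ~~ (a u && a v) && ((a u != a v) ==> S u || S v)) x s ->
  ~~ a x -> ~~ a (last x s) -> count S (x :: s) <= count a (x :: s) ->
  all (fun u => S u == a u) (x :: s).
Proof.
set e := (e in path e).
have [n] := ubnP (size s).
(* The first conjunct leaves out [x] and does not assume that [S] is small. It bounds from below
   what [S] spends further right, so that the assumption on the total count passes to the suffix. *)
suff H : size s < n -> path e x s -> ~~ a x -> ~~ a (last x s) ->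
   count a s <= count S s /\
   (count S (x :: s) <= count a (x :: s) -> all (fun u => S u == a u) (x :: s)).
  by move=> *; apply: (H _ _ _ _).2.
elim: n x s => // n IH x [|y s] /=.
  by move=> _ _ /negbTE->; case: (S x).
move=> lts /andP[exy pe] nax nal.
case ay: (a y); last first.
  have [|c1 c2] := IH y s _ pe (negbT ay) nal; first by lia.
  move: c1 c2; rewrite /= ay (negbTE nax); case: (S x); case: (S y) => /=; lia.
case: s lts pe nal => [|z s] /= lts; first by rewrite ay.
move=> /andP[eyz pe] nal.
move: exy eyz; rewrite /e ay (negbTE nax) /=; case az: (a z) => //= Sxy Syz.
have [|c1 c2] := IH z s _ pe (negbT az) nal; first by lia.
move: c1 c2 Sxy Syz; rewrite /= az.
by case: (S x); case: (S y); case: (S z) => //= c1 c2 _ _; split; lia.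
Qed.

(** Since [a] is itself a cover, a minimum cover has at most as many vertices as [a] and is thus
    forced to agree with it. *)
Lemma path_graph_min_vertex_cover (a : pred nat) x s (S : {fset nat}) :
  uniq (x :: s) -> path (fun u v => ~~ (a u && a v)) x s ->
  ~~ a x -> ~~ a (last x s) -> min_vertex_cover (path_graph (x :: s) a) S ->
  {in x :: s, forall u, (u \in S) = a u}.
Proof.
set p := x :: s => p_uniq a_sparse nax nal [[S_sub S_cov] S_min].
have a_cov : vertex_cover (path_graph p a) [fset u in p | a u].
  split=> [|u v /and4P[up vp + _]].
    by apply/fsubsetP => u; rewrite !inE => /andP[].
  by move: up vp; rewrite !inE => -> ->; case: (a u); case: (a v).
have le_count : count (mem S) p <= count a p.
  rewrite -(card_fset_count p_uniq S_sub) (leq_trans (S_min _ a_cov)) //.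
  rewrite (card_fset_count p_uniq a_cov.1); apply: sub_count => u /=.
  by rewrite !inE => /andP[].
move=> u up; apply/eqP; move: u up; apply/allP.
apply: (path_cover_forced _ nax nal le_count).
move: a_sparse => /(pathP 0) a_sparse; apply/(pathP 0) => i lti.
rewrite a_sparse //=; apply/implyP => neq; apply: S_cov.
change (path_adj p a (nth 0 p i) (nth 0 p i.+1)).
have lti1 : i.+1 < size p by [].
have lti0 := ltnW lti1.
by apply/and4P; split; rewrite ?mem_nth ?index_uniq ?eqxx.
Qed.

(** * Hard instances: triples of vertices arranged along a path *)

Definition triples (q : seq nat) : seq nat :=
  [seq (3 * i + j)%N | i <- q, j <- iota 0 3].

Lemma triples_cat q1 q2 : triples (q1 ++ q2) = triples q1 ++ triples q2.
Proof. exact: allpairs_cat. Qed.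

Lemma mem_triples q u : (u \in triples q) = (u %/ 3 \in q).
Proof.
apply/allpairsP/idP => [[[i j] /= [iq + ->]]|uq].
  by rewrite !inE => ltj; have -> : (3 * i + j) %/ 3 = i by lia.
by exists (u %/ 3, u %% 3); rewrite /= !inE; split=> //; lia.
Qed.

Lemma triples_uniq q : uniq q -> uniq (triples q).
Proof.
move=> q_uniq; apply: allpairs_uniq => //.
move=> _ _ /allpairsP[[i j] [_ ltj ->]] /allpairsP[[i' j'] [_ ltj' ->]].
by move: ltj ltj'; rewrite !inE /= => ltj ltj' eq; congr (_, _); lia.
Qed.

(** In triple [i] this selects the middle [3 * i + 1] if [X i] holds, and the two end vertices
    otherwise. *)
Definition triple_cover (X : pred nat) : pred nat :=
  fun u => (u %% 3 == 1) == X (u %/ 3).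

Lemma triple_coverE X i j : j < 3 ->
  triple_cover X (3 * i + j)%N = ((j == 1) == X i).
Proof.
move=> ltj; rewrite /triple_cover.
have -> : (3 * i + j) %/ 3 = i by lia.
by have -> : (3 * i + j) %% 3 = j by lia.
Qed.

(** Inside a triple, the middle and the ends are on different sides of the cover. Where two triples
    meet, both end vertices are covered only if neither triple is in [X]. *)
Lemma path_triples X i q : path (fun j l => X j || X l) i q ->
  path (fun u v => ~~ (triple_cover X u && triple_cover X v))
       (3 * i + 2)%N (triples q).
Proof.
elim: q i => //= j q IH i /andP[Xij /IH->].
rewrite !triple_coverE //=.
by case: (X i) Xij; case: (X j).
Qed.

Lemma last_triples i q : last (3 * i + 2)%N (triples q) = (3 * last i q + 2)%N.
Proof. by elim: q i => //= j q IH i; exact: IH. Qed.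

(** Each element of [rs] is placed just before an element of [xs]; the elements of [xs] left over
    come last. *)
Lemma alternating_arrangement (X : pred nat) (i : nat) (xs rs : seq nat) :
  X i -> all X xs -> size rs <= size xs ->
  exists q, [/\ perm_eq q (xs ++ rs), path (fun j l => X j || X l) i q &
                X (last i q)].
Proof.
elim: xs i rs => [|x xs IH] i [|r rs] //= Xi.
- by exists [::].
- case/andP=> Xx Xxs _; have [q [q_perm q_path Xq]] := IH x [::] Xx Xxs isT.
  by exists (x :: q); rewrite /= perm_cons Xi.
case/andP=> Xx Xxs les; have [q [q_perm q_path Xq]] := IH x rs Xx Xxs les.
exists [:: r, x & q]; rewrite /= Xi Xx orbT q_path Xq; split=> //.
apply/permP => P; move/permP/(_ P): q_perm.
by rewrite /= !count_cat /= => ->; lia.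
Qed.

(** The part of the input shared by all instances: nothing in it depends on [X]. *)
Definition triple_items (k : nat) : seq item :=
  [seq ((3 * i + 1)%N, [fset (3 * i + 0)%N; (3 * i + 2)%N]) | i <- iota 0 k].

Definition middle_first (k : nat) : seq nat :=
  [seq (3 * i + j)%N | j <- [:: 1; 0; 2], i <- iota 0 k].

Lemma middle_firstE k : middle_first k =
  [seq (3 * i + 1)%N | i <- iota 0 k] ++
  [seq (3 * i + j)%N | j <- [:: 0; 2], i <- iota 0 k].
Proof. by []. Qed.

Lemma middle_first_uniq k : uniq (middle_first k).
Proof.
apply: allpairs_uniq => //; first exact: iota_uniq.
move=> _ _ /allpairsP[[i j] [lti _ ->]] /allpairsP[[i' j'] [lti' _ ->]].
by move: lti lti'; rewrite !inE /= => lti lti' eq; congr (_, _); lia.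
Qed.

Lemma mem_middle_first k u : (u \in middle_first k) = (u < 3 * k).
Proof.
apply/allpairsP/idP => [[[j i] []]|ltu].
  by rewrite mem_iota !inE /= => ltj lti ->; lia.
by exists (u %% 3, u %/ 3); rewrite mem_iota !inE /=; split; lia.
Qed.

Lemma exists_triple_graph (k : nat) (X : pred nat) :
  k < 2 * count X (iota 0 k) ->
  exists G : sgraph,
    [/\ triangle_free G, max_degree_le G 3, arrival_order G (middle_first k),
        forall i, i < k ->
          neighbors G (3 * i + 1)%N = [fset (3 * i + 0)%N; (3 * i + 2)%N]
      & forall S, min_vertex_cover G S ->
          forall i, i < k -> ((3 * i + 1)%N \in S) = X i].
Proof.
move=> ltk; pose xs := filter X (iota 0 k); pose rs := filter (predC X) (iota 0 k).
have lt_size : size rs < size xs.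
  have := count_predC X (iota 0 k); rewrite size_iota !size_filter.
  move: (count _ _) (count _ _) ltk => c1 c2; lia.
have all_xs : all X xs by apply: filter_all.
have perm_xs : perm_eq (xs ++ rs) (iota 0 k) by rewrite perm_filterC.
(* The strict majority leaves one element of [X] to open the arrangement, and still at least as many
   others as there are elements of [rs]. *)
case: xs lt_size all_xs perm_xs => // x xs lt_size /= /andP[Xx all_xs] perm_xs.
have [q [q_perm q_path Xq]] := alternating_arrangement Xx all_xs lt_size.
have {q_perm}q_perm : perm_eq (x :: q) (iota 0 k).
  by rewrite (perm_trans _ perm_xs) // perm_cons.
have q_uniq : uniq (x :: q) by rewrite (perm_uniq q_perm) iota_uniq.
have p_uniq := triples_uniq q_uniq.
have mem_p u : (u \in triples (x :: q)) = (u < 3 * k).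
  by rewrite mem_triples (perm_mem q_perm) mem_iota; lia.
pose a := triple_cover X.
exists (path_graph (triples (x :: q)) a); split.
- exact: path_graph_triangle_free.
- by move=> v vG; apply: leq_trans (path_graph_max_degree vG) _.
- apply: uniq_perm; [exact: middle_first_uniq | exact: fset_uniq |].
  by move=> u; rewrite mem_middle_first in_fset mem_p.
- move=> i lti.
  have /splitPr E : i \in x :: q by rewrite (perm_mem q_perm) mem_iota.
  case: E p_uniq => q1 q2 p_uniq.
  apply: (@neighbors_path_graph _ _ p_uniq (triples q1) (triples q2)).
  + by rewrite triples_cat.
  + by rewrite /a !triple_coverE //; case: (X i).
  + by rewrite /a !triple_coverE //; case: (X i).
move=> S minS i lti.
suff -> : ((3 * i + 1)%N \in S) = a (3 * i + 1)%N by rewrite /a triple_coverE.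
apply: (path_graph_min_vertex_cover p_uniq _ _ _ minS).
- rewrite /= /a !triple_coverE //= Xx /=.
  exact: (path_triples q_path).
(* The arrangement starts and stops with a triple in [X], so its two extreme vertices are outside
   the cover. *)
- by rewrite /a triple_coverE // Xx.
- have := last_triples x q; rewrite /= => ->.
  by rewrite /a triple_coverE // Xq.
by rewrite -[_ :: _]/(triples (x :: q)) mem_p; lia.
Qed.

(** As [k] is odd there are no ties, so complementation maps the tuples without a majority
    injectively into those with one. *)
Lemma card_majority (k : nat) : odd k ->
  2 ^ k <= 2 * #|{: {X : k.-tuple bool | k < 2 * count id X}}|.
Proof.
move=> k_odd; rewrite card_sig.
set F := [pred X : k.-tuple bool | _].
have -> : 2 ^ k = #|{: k.-tuple bool}| by rewrite card_tuple card_bool.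
rewrite -(cardC F) mul2n -addnn leq_add2l.
pose neg (X : k.-tuple bool) := [tuple of map negb X].
have neg_inj : injective neg.
  by move=> X Y /(congr1 val) /= /(inj_map negb_inj) /val_inj.
rewrite -(card_image neg_inj); apply: subset_leq_card.
apply/subsetP => _ /imageP[X + ->]; rewrite !inE /= count_map -leqNgt.
have := count_predC id X; rewrite size_tuple -[predC id]/(preim negb id).
by move: (count id X) (count (preim negb id) X) => c c'; lia.
Qed.

Theorem theorem2 (A : algorithm) (O : oracle)
  (A_optimal : forall (G : sgraph) (sigma : seq nat),
     triangle_free G -> max_degree_le G 3 -> arrival_order G sigma ->
     optimal_on A O G sigma) :
  forall N : nat, exists n : nat, [/\ N <= n, 7 <= n &
    exists (G : sgraph) (sigma : seq nat) (r : nat),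
      [/\ #|` vertices G| = n, triangle_free G, max_degree_le G 3,
          arrival_order G sigma &
          reads_bits A O G sigma r /\
          ((n%:R - 4%:R) / 3%:R <= r%:R :> rat)%R]].
Proof.
(* This [k] is odd, as [card_majority] requires, and at least 3. *)
move=> N; pose k := (2 * N + 3)%N; exists (3 * k); split; [lia | lia |].
pose I := {X : k.-tuple bool | k < 2 * count id X}.
pose sigma := middle_first k.
(* For each [X], a graph together with the number of bits read on it. After the middles alone, the
   decisions spell out [X]. *)
have instance (X : I) : exists w : sgraph * nat,
    [/\ triangle_free w.1, max_degree_le w.1 3, arrival_order w.1 sigma,
        reads_bits A O w.1 sigma w.2
      & exists2 r, r <= w.2 &
          run A (O (input w.1 sigma)) (triple_items k) (val X) r].
  case: X => X /= ltk.
  have {}ltk : k < 2 * count (nth false X) (iota 0 k).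
    have -> : count (nth false X) (iota 0 k) = count id X; last by [].
    by rewrite -[in RHS](mkseq_nth false X) size_tuple count_map.
  have [G [G_tf G_deg G_sigma G_nb G_min]] := exists_triple_graph ltk.
  have [ds [r [Hrun /G_min ds_min]]] := A_optimal G sigma G_tf G_deg G_sigma.
  exists (G, r); split=> //; first by exists ds.
  have := Hrun; rewrite {2}/input /sigma middle_firstE map_cat.
  have -> : [seq (v, neighbors G v) | v <- [seq (3 * i + 1)%N | i <- iota 0 k]]
            = triple_items k.
    rewrite -map_comp; apply/eq_in_map => i; rewrite mem_iota => /andP[_ lti].
    by rewrite /= G_nb.
  move=> /run_prefix [r1 le1]; rewrite size_map size_iota => Hrun1.
  exists r1 => //; congr (run _ _ _ _ _): Hrun1.
  have size_ds : size ds = (3 * k)%N.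
    by rewrite (run_size Hrun) /input size_map size_allpairs size_iota.
  apply: (@eq_from_nth _ false).
    by rewrite size_tuple size_takel // size_ds; lia.
  rewrite size_takel ?size_ds => [i lti|]; last by lia.
  (* Position [i] of the arrival order holds the middle [3 * i + 1], so decision [i] tells whether
     that middle is in the forced cover. *)
  rewrite nth_take // -(ds_min i lti) in_fset in_mask ?middle_first_uniq //.
  rewrite mem_middle_first; have -> : 3 * i + 1 < 3 * k by lia.
  have -> : (3 * i + 1)%N = nth 0 sigma i.
    rewrite /sigma middle_firstE nth_cat size_map size_iota lti.
    by rewrite (nth_map 0) ?size_iota // nth_iota.
  rewrite index_uniq ?middle_first_uniq //.
  by rewrite size_allpairs size_iota /=; lia.
have [w Hw] := fin_all_exists instance.
(* If every instance were served with [k - 2] bits, there would be at most [2 ^ (k - 2)] majority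
   sets, but there are at least [2 ^ (k - 1)]. So some instance needs [k - 1] bits, and
   [3 * (k - 1)] exceeds [n - 4] by one. *)
have [X ltX] : exists X, k.-2 < (w X).2.
  apply/existsP; apply: contraT; rewrite negb_exists => /forallP small.
  have le_card : #|{: I}| <= 2 ^ k.-2.
    apply: (@advice_lower_bound A (triple_items k) _ _
              (fun X => O (input (w X).1 sigma)) (fun X => val (val X))).
      move=> X; have [_ _ _ _ [r ler Hr]] := Hw X; exists r => //.
      by apply: leq_trans ler _; rewrite leqNgt.
    by move=> X Y /val_inj/val_inj.
  have k_odd : odd k by rewrite /k; lia.
  have := card_majority k_odd; rewrite -/I.
  have -> : 2 ^ k = 4 * 2 ^ k.-2 by rewrite -(expnD 2 2); congr (2 ^ _); lia.
  by have := expn_gt0 2 k.-2; lia.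
have [G_tf G_deg G_sigma G_reads _] := Hw X.
exists (w X).1, sigma, (w X).2; split=> //.
  rewrite -(perm_size G_sigma) /sigma size_allpairs size_iota /=; lia.
split=> //.
rewrite ler_pdivrMr ?ltr0n // lerBlDr -natrM -natrD ler_nat.
move: ltX; rewrite /k; lia.
Qed.
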